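(* Let $I\subseteq[n]$ be nonempty with $I\neq[1,j]$ for every $j\in[n]$. Then the Schubert matroid polytope $Q(\theta_I)$ is a prime MV polytope. Furthermore, if $I\neq J$ are two distinct such subsets of $[n]$, then $Q(\theta_I)$ and $Q(\theta_J)$ represent distinct stable MV polytopes.
   Context: Notation: $[n]=\{1,\dots,n\}$, $[a,b]=\{a,a+1,\dots,b\}$; $Xij$ means $X\cup\{i,j\}$, etc.; $x(S)=\sum_{i\in S}x_i$. For $k$-subsets $L=\{l_1<\dots<l_k\}$ and $I=\{i_1<\dots<i_k\}$ of $[n]$, write $L\le_G I$ if $l_r\le i_r$ for all $r$. The Schubert matroid $\Omega_I$ is the matroid on $[n]$ whose bases are the $k$-subsets $L$ with $L\le_G I$, where $k=|I|$. Its rank function is $\theta_I(S)=\max\{|S\cap L| : L \text{ a basis of }\Omega_I\}$. A function $f:2^{[n]}\to\mathbb R$ is a DCTP (discrete concave tropical Plücker) function if it is submodular, $f(X)+f(Y)\ge f(X\cap Y)+f(X\cup Y)$ for all $X,Y$, and satisfies $f(Xik)+f(Xj)=\max\{f(Xij)+f(Xk),\,f(Xjk)+f(Xi)\}$ for all $i<j<k$ in $[n]$ and $X\subseteq[n]\setminus\{i,j,k\}$. For such $f$ with $f(\emptyset)=0$, put $Q(f)=\{x\in\mathbb R^n : x(S)\le f(S)\ \forall S\subsetneq[n],\ x([n])=f([n])\}$. A (type A) MV polytope is a polytope $Q(f)$ for a $\mathbb Z$-valued DCTP function $f$ with $f(\emptyset)=0$. A stable MV polytope is an equivalence class of MV polytopes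 under translation. The fan $\mathcal{MV}$: for each choice function $\epsilon$ that assigns to every triple $i<j<k$ and every $X\subseteq[n]\setminus\{i,j,k\}$ one of the two terms $f(Xij)+f(Xk)$, $f(Xjk)+f(Xi)$, let $C_\epsilon$ be the polyhedral cone of real submodular functions $f$ on $2^{[n]}$ such that $f(Xik)+f(Xj)$ equals the chosen term and is $\ge$ the other term, for all $(X,i,j,k)$. The cones $C_\epsilon$ and all their faces form a fan whose support is the set of all DCTP functions. Its lineality space consists of the functions $f(S)=c+\sum_{i\in S}z_i$ ($c\in\mathbb R$, $z\in\mathbb R^n$), and $\mathcal{MV}$ is the quotient of this fan by the lineality space. An MV polytope $Q(f)$ is prime if the class of $f$ spans a one-dimensional cone (ray) of $\mathcal{MV}$. *)

(* Defs.v *)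
From mathcomp Require Import all_boot all_order all_algebra.
From mathcomp Require Import boolp classical_sets reals.

Set Implicit Arguments.
Unset Strict Implicit.
Unset Printing Implicit Defensive.

Import Order.TTheory GRing.Theory Num.Theory.
Local Open Scope ring_scope.

(* The ground set [n] = {1, ..., n} is 'I_n = {0, ..., n-1}, with its order. *)

Section SchubertMatroid.
Variable n : nat.
Implicit Types I L S : {set 'I_n}.

(* [enum] lists the elements of a set of ordinals in increasing order, and
   [all2] is false on sequences of different sizes: hence L and I have the same
   cardinality and are compared entrywise. *)
Definition gale_le L I : bool :=
  all2 (fun l i : 'I_n => (l <= i)%N) (enum L) (enum I).

Definition schubert_bases I : {set {set 'I_n}} :=
  [set L : {set 'I_n} | gale_le L I]%SET.

Definition schubert_rank I S : nat :=
  \max_(L in schubert_bases I) #|S :&: L|.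

Definition initial_segment (j : 'I_n) : {set 'I_n} :=
  [set i : 'I_n | (i <= j)%N]%SET.

Definition schubert_index I : Prop :=
  I <> finset.set0 /\ forall j : 'I_n, I <> initial_segment j.

End SchubertMatroid.

Section DCTP.
Variables (R : realType) (n : nat).
Implicit Types (f : {set 'I_n} -> R) (X Y S : {set 'I_n}) (i j k : 'I_n).

Definition submodular f : Prop :=
  forall X Y, f (X :&: Y) + f (X :|: Y) <= f X + f Y.

Definition triple_off i j k X : Prop :=
  [/\ (i < j)%N, (j < k)%N & [/\ i \notin X, j \notin X & k \notin X]].

Definition plucker_mid f i j k X : R :=
  f (X :|: [set i; k]%SET) + f (X :|: [set j]%SET).

(* The two terms that compete in the tropical Pluecker relation: [true] stands
   for f(Xij) + f(Xk), and [false] for f(Xjk) + f(Xi). *)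
Definition plucker_term (b : bool) f i j k X : R :=
  if b then f (X :|: [set i; j]%SET) + f (X :|: [set k]%SET)
  else f (X :|: [set j; k]%SET) + f (X :|: [set i]%SET).

Definition dctp f : Prop :=
  submodular f /\
  forall i j k X, triple_off i j k X ->
    plucker_mid f i j k X =
    Num.max (plucker_term true f i j k X) (plucker_term false f i j k X).

Definition base_polytope f : set 'rV[R]_n :=
  [set x : 'rV[R]_n |
    (forall S, S \proper [set: 'I_n]%SET -> \sum_(i in S) x 0 i <= f S) /\
    \sum_i x 0 i = f [set: 'I_n]%SET]%classic.

Definition integral_dctp f : Prop :=
  [/\ dctp f, f finset.set0 = 0 & forall S, f S \is a Num.int].

Definition MV_polytope (P : set 'rV[R]_n) : Prop :=
  exists2 f, integral_dctp f & P = base_polytope f.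

Definition translate (z : 'rV[R]_n) (P : set 'rV[R]_n) : set 'rV[R]_n :=
  [set z + x | x in P]%classic.

(* The class, under translation, of P among the MV polytopes. *)
Definition stable_MV (P : set 'rV[R]_n) : set (set 'rV[R]_n) :=
  [set P' | MV_polytope P' /\ exists z, P' = translate z P]%classic.

End DCTP.

Section Fan.
Variables (R : realType) (n : nat).

Definition setfun : lmodType R := {ffun {set 'I_n} -> R^o}.

Definition choice_fun : Type := 'I_n -> 'I_n -> 'I_n -> {set 'I_n} -> bool.

Definition dctp_cone (eps : choice_fun) : set setfun :=
  [set f : setfun | submodular f /\
    forall i j k X, triple_off i j k X ->
      plucker_mid f i j k X = plucker_term (eps i j k X) f i j k X /\
      plucker_term (~~ eps i j k X) f i j k X <= plucker_mid f i j k X]%classic.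

(* The faces of a cone, itself included (l = 0), are its intersections with its
   supporting hyperplanes. *)
Definition is_face (F C : set setfun) : Prop :=
  exists l : {scalar setfun},
    (forall f, C f -> 0 <= l f) /\ F = [set f | C f /\ l f = 0]%classic.

Definition dctp_fan : set (set setfun) :=
  [set F | exists eps, is_face F (dctp_cone eps)]%classic.

Definition lineality : set setfun :=
  [set f : setfun | exists (c : R) (z : 'I_n -> R),
    forall S : {set 'I_n}, f S = c + \sum_(i in S) z i]%classic.

(* Points of the quotient by the lineality space are cosets, so that the cones
   of the quotient fan are sets of cosets. *)
Definition lin_class (f : setfun) : set setfun :=
  [set g | lineality (g - f)]%classic.

Definition MV_fan : set (set (set setfun)) :=
  [set lin_class @` F | F in dctp_fan]%classic.

Definition class_ray (f : setfun) : set (set setfun) :=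
  [set lin_class (t *: f) | t in [set t : R | 0 <= t]]%classic.

(* The cone generated by one vector is one-dimensional when that vector is
   nonzero. *)
Definition spans_ray (f : setfun) : Prop :=
  lin_class f <> lin_class 0 /\ MV_fan (class_ray f).

Definition prime_MV_polytope (P : set 'rV[R]_n) : Prop :=
  exists f : setfun, [/\ integral_dctp f, P = base_polytope f & spans_ray f].

Definition schubert_polytope (I : {set 'I_n}) : set 'rV[R]_n :=
  base_polytope (fun S => (schubert_rank I S)%:R).

End Fan.

Arguments schubert_polytope R {n} I.

(* Main.v *)
Require Import Defs.
(* The rank of S in the Schubert matroid is the minimum over p of
   |S below p| + |I from p on|; submodularity and monotonicity in the Gale order
   follow, and these force the tropical Pluecker relations.

   Primality only needs the submodular inequalities that are tight at the rank
   function r. If f is submodular with equality wherever r has equality, then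
   the pairs (X, {i}) and (Xi, T \ i) show that f(Xi) - f(X) takes only two
   values, one for each value of r(Xi) - r(X). When i is neither a loop nor a
   coloop, let gap i be the difference of these two values. If i and a are
   parallel after contracting some X, then gap i = gap a. In a Schubert matroid
   the least a outside I is in this relation with every i that is neither a loop
   nor a coloop, so f = gap(a) * r up to an affine function, and gap(a) >= 0 by
   submodularity.

   For the second part, r is the support function of the polytope, so a
   translation by z gives r_I = r_J + z. The elements that are neither loops nor
   coloops are the same for both, the largest of them is max I = max J, hence
   loops agree, z = 0, and r_I determines I. *)

From HB Require Import structures.
From mathcomp Require Import all_boot all_order all_algebra.
From mathcomp Require Import boolp classical_sets reals.
From mathcomp Require Import zify lra.

Set Implicit Arguments.
Unset Strict Implicit.
Unset Printing Implicit Defensive.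

Import Order.TTheory GRing.Theory Num.Theory.

(** * Entrywise order on sorted sequences, and counting under an exchange *)

Lemma all2_leq_count (s t : seq nat) p :
  all2 leq s t -> (count (leq p) s <= count (leq p) t)%N.
Proof.
elim: s t => [|x s IHs] [|y t] //= /andP[lexy /IHs]; case: leqP; lia.
Qed.

(** The threshold at the head [x] counts all of [s], so [y < x] would make the count for [t] too
    small. For the tails, a threshold up to [y] counts all of [t], and a larger one counts neither
    head. *)
Lemma count_leq_all2 (s t : seq nat) :
    sorted leq s -> sorted leq t -> size s = size t ->
  (forall p, (count (leq p) s <= count (leq p) t)%N) -> all2 leq s t.
Proof.
elim: s t => [|x s IHs] [|y t] //= xs yt [sz] cnt.
have count_ge z u q : path leq z u -> (q <= z)%N -> count (leq q) u = size u.
  move=> /(order_path_min leq_trans)/allP zu leqz.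
  by apply/eqP; rewrite -all_count; apply/allP => w /zu; apply: leq_trans.
have lexy : (x <= y)%N.
  rewrite leqNgt; apply/negP => ltyx; have := cnt x.
  rewrite leqnn (count_ge _ _ _ xs) // [(x <= y)%N]leqNgt ltyx /= sz.
  by have := count_size (leq x) t; lia.
rewrite lexy /= IHs ?(path_sorted xs) ?(path_sorted yt) // => p.
have [lepy|ltyp] := leqP p y.
  by rewrite (count_ge _ _ _ yt) // -sz count_size.
by have := cnt p; rewrite ![(p <= _)%N]leqNgt ltyp (leq_ltn_trans lexy).
Qed.

Section SetCard.
Variable T : finType.
Implicit Types A U : {set T}.

Lemma card_sum_mem A : #|A| = (\sum_x (x \in A))%N.
Proof. by rewrite -sum1_card big_mkcond; apply: eq_bigr => x _; case: ifP. Qed.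

(** Stated additively, to avoid truncated subtraction. *)
Lemma card_exchange A U (x y : T) : y \in A -> x \notin A ->
  (#|(x |: (A :\ y)) :&: U| + (y \in U) = #|A :&: U| + (x \in U))%N.
Proof.
move=> yA xA; have neqxy : x != y by apply: contraNneq xA => ->.
have cardI B : #|B :&: U| = (\sum_(z in B) (z \in U))%N.
  rewrite card_sum_mem [RHS]big_mkcond; apply: eq_bigr => z _.
  by rewrite inE; case: (z \in B).
rewrite !cardI big_setU1 ?inE ?(negPf xA) ?andbF //= (big_setD1 y yA) /=; lia.
Qed.

End SetCard.

(** * Rank formula by cuts, submodularity and the tropical Plücker relation *)

Section SchubertRank.
Import boot.fintype boot.finset.
Variable n : nat.
Implicit Types (I J L S X Y : {set 'I_n}) (i j k x y : 'I_n) (p q : nat).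

Definition upper p : {set 'I_n} := [set x : 'I_n | (p <= x)%N]%SET.

Lemma in_upper p x : (x \in upper p) = (p <= x)%N.
Proof. by rewrite inE. Qed.

Lemma upper0 : upper 0 = [set: 'I_n]%SET.
Proof. by apply/setP => x; rewrite !inE. Qed.

Lemma count_enum_upper L p :
  count (leq p) (map val (enum L)) = #|L :&: upper p|.
Proof.
rewrite count_map cardE -size_filter /enum_mem; congr size.
rewrite -filter_predI; apply: eq_filter => x.
by rewrite !inE andbC.
Qed.

(** Upper-tail counts replace the entrywise comparison, since an exchange changes them in a
    controlled way. *)
Lemma gale_leP L I :
  reflect (#|L| = #|I| /\ forall p, (#|L :&: upper p| <= #|I :&: upper p|)%N)
          (gale_le L I).
Proof.
have all2E : gale_le L I = all2 leq (map val (enum L)) (map val (enum I)).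
  rewrite /gale_le; elim: (enum L) (enum I) => [|x s IHs] [|y t] //=.
  by rewrite IHs.
have sorted_enum S : sorted leq (map val (enum S)).
  rewrite sorted_map; apply: (@subseq_sorted _ _ _ _ (enum 'I_n)).
  - by move=> ? ? ?; apply: leq_trans.
  - by rewrite enumT; apply: filter_subseq.
  - by rewrite -sorted_map val_enum_ord iota_sorted.
rewrite all2E; apply: (iffP idP) => [LI|[cLI LI]].
  split=> [|p]; last by rewrite -!count_enum_upper all2_leq_count.
  by move: LI; rewrite seq.all2E !size_map -!cardE => /andP[/eqP].
by apply: count_leq_all2; rewrite ?size_map -?cardE // => p; rewrite !count_enum_upper.
Qed.

Lemma schubert_base_self I : I \in schubert_bases I.
Proof. by rewrite inE; apply/gale_leP. Qed.

Lemma schubert_base_card I L : L \in schubert_bases I -> #|L| = #|I|.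
Proof. by rewrite inE => /gale_leP[]. Qed.

Lemma schubert_rank_ge I L S : L \in schubert_bases I ->
  (#|S :&: L| <= schubert_rank I S)%N.
Proof. exact: (leq_bigmax_cond (F := fun L => #|S :&: L|)). Qed.

Lemma schubert_rankP I S :
  exists2 L, L \in schubert_bases I & schubert_rank I S = #|S :&: L|.
Proof.
have bases_gt0 : (0 < #|schubert_bases I|)%N.
  by apply/card_gt0P; exists I; apply: schubert_base_self.
by have [L LI rkS] := eq_bigmax_cond (fun L => #|S :&: L|) bases_gt0; exists L.
Qed.

Definition cut_value I p S : nat := (#|S :\: upper p| + #|I :&: upper p|)%N.

(** A basis meets [S] below [p] in at most all of that part, and the Gale order bounds its number of
    elements from [p] on by that of [I]. *)
Lemma schubert_rank_le_cut I p S : (schubert_rank I S <= cut_value I p S)%N.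
Proof.
have [L] := schubert_rankP I S; rewrite inE => /gale_leP[_ LI] ->.
rewrite -(cardsID (upper p)) addnC leq_add //.
  by rewrite subset_leq_card // setSD // subsetIl.
by rewrite (leq_trans _ (LI p)) // subset_leq_card // setSI // subsetIr.
Qed.

(* Exchange argument: take a basis [L] with [S :&: L] of maximal size, [x] the
   least element of [S :\: L] and [p <= x] the largest position where the Gale
   constraint on [L] is tight. An element of [L :\: S] above [p] could be
   exchanged for [x], hence [L :&: upper p \subset S]. *)
Lemma schubert_rank_cut I S : exists p, schubert_rank I S = cut_value I p S.
Proof.
have [L LI rkS] := schubert_rankP I S.
have [cLI cutL] : #|L| = #|I| /\
    forall p, (#|L :&: upper p| <= #|I :&: upper p|)%N.
  by move: LI; rewrite inE => /gale_leP.
have [sSL|] := boolP (S \subset L).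
  (* Nothing lies above [n], so this cut has value [#|S|]. *)
  exists n; rewrite rkS /cut_value.
  have -> : upper n = set0 by apply/setP => x; rewrite !inE leqNgt ltn_ord.
  by rewrite setD0 setI0 cards0 addn0 (setIidPl sSL).
case/subsetPn => x0 x0S x0L.
have x0D : x0 \in S :\: L by rewrite inE x0S x0L.
case: (@arg_minnP _ x0 (mem (S :\: L)) val x0D) => x /=.
rewrite inE => /andP[xL xS] xmin.
pose tight p := (p <= x)%N && (#|L :&: upper p| == #|I :&: upper p|).
have tight0 : exists p, tight p.
  by exists 0%N; rewrite /tight upper0 !setIT cLI eqxx.
have tightle p : tight p -> (p <= x)%N by case/andP.
case: (ex_maxnP tight0 tightle) => p /andP[lepx /eqP tp] pmax.
have sLS : L :&: upper p \subset S.
  apply/subsetP => y; rewrite inE in_upper => /andP[yL lepy].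
  apply/negPn/negP => yS.
  suff LI' : x |: (L :\ y) \in schubert_bases I.
    have := schubert_rank_ge S LI'; rewrite rkS ![S :&: _]setIC.
    have := card_exchange S yL xL; rewrite xS (negPf yS); lia.
  rewrite inE; apply/gale_leP; split=> [|q].
    by have := card_exchange setT yL xL; rewrite !inE !setIT; lia.
  (* The exchange raises the count from [q] on only if [y < q <= x]; then [p < q], and maximality of
     [p] leaves room for one more element. *)
  have := card_exchange (upper q) yL xL; rewrite !in_upper.
  have := cutL q; have [leqx|ltxq] := leqP q x; last by lia.
  have [leqp|ltpq] := leqP q p; first by rewrite (leq_trans leqp lepy); lia.
  suff : #|L :&: upper q| != #|I :&: upper q| by lia.
  by apply/negP => tq; have := pmax q; rewrite /tight leqx tq; lia.
exists p; rewrite rkS -(cardsID (upper p)) /cut_value -tp addnC; congr (_ + _)%N.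
  apply/eq_card => z; rewrite !inE -ltnNge; case: ltnP => //= ltzp.
  case zS: (z \in S) => //=; apply/negPn/negP => zL.
  by have := xmin z; rewrite !inE zL zS => /(_ isT); lia.
apply/eq_card => z; have := subsetP sLS z; rewrite !inE.
by case: (z \in L); case: (p <= z)%N; case: (z \in S) => //= ->.
Qed.

Lemma card_setU1D X p i : i \notin X ->
  #|(i |: X) :\: upper p| = ((i < p) + #|X :\: upper p|)%N.
Proof.
move=> iX; have := cardsU1 i X; rewrite -!(cardsID (upper p) (_ |: _)).
have [ltip|lepi] := ltnP i p.
  have -> : (i |: X) :\: upper p = i |: (X :\: upper p).
    apply/setP => z; rewrite !inE; case: eqP => // ->.
    by rewrite leqNgt ltip.
  by rewrite cardsU1 !inE (negPf iX) andbF.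
have -> : (i |: X) :\: upper p = X :\: upper p.
  by apply/setP => z; rewrite !inE; case: eqP => // ->; rewrite lepi.
by [].
Qed.

Lemma schubert_rank0 I : schubert_rank I set0 = 0%N.
Proof. by have [L _ ->] := schubert_rankP I set0; rewrite set0I cards0. Qed.

Lemma schubert_rank_le_card I S : (schubert_rank I S <= #|S|)%N.
Proof. by have [L _ ->] := schubert_rankP I S; rewrite subset_leq_card ?subsetIl. Qed.

Lemma schubert_rank_le_base I S : (schubert_rank I S <= #|I|)%N.
Proof.
have [L LI ->] := schubert_rankP I S.
by rewrite -(schubert_base_card LI) subset_leq_card ?subsetIr.
Qed.

Lemma schubert_rank_base I L : L \in schubert_bases I -> schubert_rank I L = #|I|.
Proof.
move=> LI; apply/eqP; rewrite eqn_leq schubert_rank_le_base /=.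
by rewrite -(schubert_base_card LI) -{1}(setIid L) schubert_rank_ge.
Qed.

Lemma schubert_rank_mono I X Y :
  X \subset Y -> (schubert_rank I X <= schubert_rank I Y)%N.
Proof.
move=> sXY; have [L LI ->] := schubert_rankP I X.
by rewrite (leq_trans _ (schubert_rank_ge Y LI)) // subset_leq_card ?setSI.
Qed.

Lemma schubert_rankT I : schubert_rank I setT = #|I|.
Proof.
apply/eqP; rewrite eqn_leq schubert_rank_le_base -(schubert_rank_base (schubert_base_self I)).
by rewrite schubert_rank_mono ?subsetT.
Qed.

Lemma schubert_rank_setU1 I i X :
  (schubert_rank I X <= schubert_rank I (i |: X) <= (schubert_rank I X).+1)%N.
Proof.
rewrite schubert_rank_mono ?subsetUr //=.
have [iX|iX] := boolP (i \in X).
  by rewrite (setUidPr _) ?sub1set // leqW.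
have [p rkX] := schubert_rank_cut I X.
have := schubert_rank_le_cut I p (i |: X).
by rewrite rkX /cut_value (card_setU1D _ iX); case: (i < p)%N; lia.
Qed.

(** Take optimal cuts [p <= q] for the two sets; cutting the union at [p] and the intersection at
    [q] reduces the claim to an elementwise check. *)
Lemma schubert_rank_submodular I X Y :
  (schubert_rank I (X :&: Y) + schubert_rank I (X :|: Y) <=
   schubert_rank I X + schubert_rank I Y)%N.
Proof.
have [p rkX] := schubert_rank_cut I X; have [q rkY] := schubert_rank_cut I Y.
wlog lepq : X Y p q rkX rkY / (p <= q)%N => [submod|].
  have [|/ltnW] := leqP p q; first exact: submod rkX rkY.
  by rewrite setIC setUC [(_ X + _)%N]addnC; apply: submod rkY rkX.
have := schubert_rank_le_cut I p (X :|: Y).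
have := schubert_rank_le_cut I q (X :&: Y).
rewrite rkX rkY /cut_value => leI leU.
suff : (#|(X :&: Y) :\: upper q| + #|(X :|: Y) :\: upper p| <=
        #|X :\: upper p| + #|Y :\: upper q|)%N by lia.
rewrite !card_sum_mem -!big_split /=; apply: leq_sum => x _; rewrite !inE.
have : (q <= x)%N ==> (p <= x)%N by apply/implyP; apply: leq_trans.
by case: (q <= x)%N (p <= x)%N (x \in X) (x \in Y) => [] [] [] [].
Qed.

(** At an optimal cut for [i |: X], replacing [i] by the larger [k] cannot increase the number of
    elements below the cut. *)
Lemma schubert_rank_gale I i k X : (i < k)%N -> i \notin X -> k \notin X ->
  (schubert_rank I (k |: X) <= schubert_rank I (i |: X))%N.
Proof.
move=> ltik iX kX; have [p ->] := schubert_rank_cut I (i |: X).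
rewrite (leq_trans (schubert_rank_le_cut I p _)) // leq_add2r !card_setU1D //.
by rewrite leq_add2r; case: (ltnP k p) => // /(ltn_trans ltik) ->.
Qed.

(** Unit increments, four local submodular inequalities and four Gale comparisons among the eight
    sets from [X] to [Xijk] imply the relation by linear arithmetic. *)
Lemma schubert_rank_plucker I i j k X : triple_off i j k X ->
  let r := schubert_rank I in
  (r (X :|: [set i; k]) + r (X :|: [set j]) =
   maxn (r (X :|: [set i; j]) + r (X :|: [set k]))
        (r (X :|: [set j; k]) + r (X :|: [set i])))%N.
Proof.
case=> ltij ltjk [iX jX kX] r.
have [neij nejk neik] : [/\ i != j, j != k & i != k] by split; rewrite -val_eqE /=; lia.
have ltik : (i < k)%N by apply: ltn_trans ltjk.
rewrite ![X :|: [set _]]setUC.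
have pairE x y : X :|: [set x; y] = x |: (y |: X).
  by rewrite setUC -setUA.
rewrite !{}pairE.
have swap x y Y : x |: (y |: Y) = y |: (x |: Y) by rewrite setUCA.
have sub x y Y : x != y -> x \notin Y ->
    (r Y + r (x |: (y |: Y)) <= r (x |: Y) + r (y |: Y))%N.
  move=> nexy xY; have := schubert_rank_submodular I (x |: Y) (y |: Y).
  rewrite -setUIl -setUUl; have -> : [set x] :&: [set y] = set0.
    by apply/setP => z; rewrite !inE; case: eqP => // ->; apply/negbTE.
  by rewrite set0U -setUA.
have notin x y : x != y -> x \notin X -> x \notin y |: X.
  by move=> ne xX; rewrite !inE negb_or ne.
have U1 x Y : (r Y <= r (x |: Y) <= (r Y).+1)%N by apply: schubert_rank_setU1.
have neji : j != i by rewrite eq_sym.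
have neki : k != i by rewrite eq_sym.
have nekj : k != j by rewrite eq_sym.
have := schubert_rank_gale I ltij iX jX.
have := schubert_rank_gale I ltjk jX kX.
have := schubert_rank_gale I ltjk (notin _ _ neji jX) (notin _ _ neki kX).
have := schubert_rank_gale I ltij (notin _ _ neik iX) (notin _ _ nejk jX).
have := sub i j (k |: X) neij (notin _ _ neik iX).
have := sub i j X neij iX; have := sub i k X neik iX; have := sub j k X nejk jX.
have := U1 i X; have := U1 j X; have := U1 k X.
have := U1 i (j |: X); have := U1 i (k |: X); have := U1 j (k |: X).
have := U1 k (i |: X); have := U1 j (i |: X); have := U1 k (j |: X).
have := U1 k (i |: (j |: X)).
rewrite (swap k i (j |: X)) (swap k j X) (swap k i X) (swap j i X) -/r.
clearbody r; move: (r X) (r (i |: X)) (r (j |: X)) (r (k |: X)).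
move: (r (i |: (j |: X))) (r (i |: (k |: X))) (r (j |: (k |: X))).
by move: (r (i |: (j |: (k |: X)))); lia.
Qed.
End SchubertRank.

(** * Submodular functions tight wherever a given rank function is tight *)

Section Rigidity.
Import boot.fintype boot.finset.
Local Open Scope ring_scope.
Variables (R : realFieldType) (T : finType) (r : {set T} -> nat).
Variables (f : {set T} -> R) (a : T).
Implicit Types (i : T) (X Y S : {set T}).
Hypothesis r0 : r set0 = 0%N.
Hypothesis r_setU1 : forall i X, (r X <= r (i |: X) <= (r X).+1)%N.
Hypothesis r_submodular : forall X Y, (r (X :&: Y) + r (X :|: Y) <= r X + r Y)%N.
Hypothesis tight : forall X Y, (r (X :&: Y) + r (X :|: Y) = r X + r Y)%N ->
  f (X :&: Y) + f (X :|: Y) = f X + f Y.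
Hypothesis parallel_a : forall i, r [set i] = 1%N -> r (~: [set i]) = r setT ->
  i != a -> exists X, [/\ i \notin X, a \notin X, r (i |: X) = (r X).+1,
    r (a |: X) = (r X).+1 & r (i |: (a |: X)) = (r X).+1].

Definition gap i : R := f [set i] + f (~: [set i]) - f set0 - f setT.

Lemma incr_tight1 i X : i \notin X -> r (i |: X) = (r [set i] + r X)%N ->
  f (i |: X) = f X + f [set i] - f set0.
Proof.
move=> iX ri; have := @tight [set i] X.
have -> : [set i] :&: X = set0.
  by apply/setP => z; rewrite !inE; case: eqP => // ->; apply/negbTE.
by rewrite r0 ri => /(_ erefl); lra.
Qed.

(** The pair [i |: X], [~: [set i]] has meet [X] and join [setT]; submodularity of [r] excludes that
    [i] is a coloop and makes this pair tight. *)
Lemma incr_tight0 i X : i \notin X -> r (i |: X) = r X ->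
  r (~: [set i]) = r setT /\ f (i |: X) = f X + f setT - f (~: [set i]).
Proof.
move=> iX ri; have := @tight (i |: X) (~: [set i]).
have := r_submodular (i |: X) (~: [set i]); have := r_setU1 i (~: [set i]).
rewrite setUCr.
have -> : (i |: X) :&: ~: [set i] = X.
  by apply/setP => z; rewrite !inE; case: eqP => [->|] //=; rewrite ?andbT ?(negPf iX).
have -> : (i |: X) :|: ~: [set i] = setT.
  by apply/setP => z; rewrite !inE; case: eqP; rewrite ?orbT.
rewrite ri => mono submod eqf; have rE : r (~: [set i]) = r setT by lia.
by split=> //; have := eqf ltac:(lia); lra.
Qed.

(** Compute [f] at [X] with [i] and [a] added in both orders: each time the first insertion raises
    the rank and the second does not. *)
Lemma gap_eq i : r [set i] = 1%N -> r (~: [set i]) = r setT -> gap i = gap a.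
Proof.
move=> ri rCi; have [->//|neia] := eqVneq i a.
have [X [iX aX rX raX riaX]] := parallel_a ri rCi neia.
have ra : r [set a] = 1%N.
  have := r_submodular [set a] X; have := r_setU1 a set0.
  have -> : [set a] :&: X = set0.
    by apply/setP => z; rewrite !inE; case: eqP => // ->; apply/negbTE.
  by rewrite setU0 r0 raX; lia.
have iaX : i \notin a |: X by rewrite !inE negb_or neia.
have aiX : a \notin i |: X by rewrite !inE negb_or eq_sym neia.
have riaX' : r (a |: (i |: X)) = r (i |: X) by rewrite setUCA riaX.
have [_ f_ia] := incr_tight0 iaX (etrans riaX (esym raX)).
have [_] := incr_tight0 aiX riaX'; rewrite setUCA f_ia.
have := incr_tight1 iX; rewrite ri => /(_ rX) ->.
have := incr_tight1 aX; rewrite ra => /(_ raX) -> /eqP; rewrite /gap => /eqP; lra.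
Qed.

(** Insert the elements of [S] one by one. Either the rank increment of [i] is the one at the empty
    set, or it drops from 1 to 0; then [i] is neither a loop nor a coloop, and [gap i] becomes
    [gap a]. *)
Lemma connected_rank_rigid S :
  f S = f set0 + \sum_(i in S) (f [set i] - f set0 - gap a * (r [set i])%:R)
        + gap a * (r S)%:R.
Proof.
elim: {S}_.+1 {-2}S (ltnSn #|S|) => // m IHm S cardS.
have [->|[i iS]] := set_0Vmem S; first by rewrite r0 big_set0 mulr0 !addr0.
have iX : i \notin S :\ i by rewrite !inE eqxx.
rewrite -(setD1K iS) big_setU1 //=; move: cardS; rewrite (cardsD1 i) iS.
move: (S :\ i) iX => X iX cardX; have {IHm} := IHm X ltac:(lia).
set s := \sum_(_ in X) _ => fX.
have := r_setU1 i X; have := r_setU1 i set0; rewrite setU0 r0 => ri riX.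
have := r_submodular [set i] X.
have -> : [set i] :&: X = set0.
  by apply/setP => z; rewrite !inE; case: eqP => // ->; apply/negbTE.
rewrite r0 add0n => le_riX.
have [eq_riX|ne_riX] := eqVneq (r (i |: X)) (r [set i] + r X)%N.
  by rewrite incr_tight1 // eq_riX natrD fX; lra.
have ri1 : r [set i] = 1%N by lia.
have eq_riX : r (i |: X) = r X by lia.
have [rCi ->] := incr_tight0 iX eq_riX.
by rewrite fX eq_riX ri1 -(gap_eq ri1 rCi) mulr1 /gap; lra.
Qed.
End Rigidity.

(** * Loops, coloops and parallel elements in Schubert matroids *)

Section SchubertIndex.
Import boot.fintype boot.finset.
Variable n : nat.
Implicit Types (I J L S X Y : {set 'I_n}) (a i m x y : 'I_n) (p : nat).

Lemma schubert_base_exchange I x y : y \in I -> x \notin I -> (x < y)%N ->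
  x |: (I :\ y) \in schubert_bases I.
Proof.
move=> yI xI ltxy; rewrite inE; apply/gale_leP; split=> [|p].
  by have := card_exchange setT yI xI; rewrite !inE !setIT => /addIn.
rewrite -(leq_add2r (y \in upper n p)) card_exchange // leq_add2l !in_upper.
by case: (leqP p x) => // /leq_ltn_trans/(_ ltxy)/ltnW ->.
Qed.

(** Here [m] is the maximum of [I] and [a] the least element outside [I]; if nothing below [m] were
    missing, [I] would be an initial segment. *)
Lemma schubert_indexP I : schubert_index I ->
  exists a m, [/\ a \notin I, forall i, (i < a)%N -> i \in I, m \in I,
                  forall i, i \in I -> (i <= m)%N & (a < m)%N].
Proof.
case=> /eqP /set0Pn[m0 m0I] notinit.
case: (@arg_maxnP _ m0 (mem I) val m0I) => m /= mI mmax.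
have : ~~ (initial_segment m \subset I).
  apply/negP => sI; case: (notinit m); apply/eqP; rewrite eqEsubset sI andbT.
  by apply/subsetP => i iI; rewrite inE mmax.
case/subsetPn => a0; rewrite inE => lea0m a0I.
case: (@arg_minnP _ a0 [pred i | i \notin I] val a0I) => a /= aI amin.
exists a, m; split=> // [i ltia|].
  by apply/negPn/negP => /amin; rewrite leqNgt ltia.
rewrite ltn_neqAle (leq_trans (amin _ a0I) lea0m) andbT.
by apply: contraNneq aI => /val_inj ->.
Qed.

Lemma schubert_rank_nonloop I i : schubert_rank I [set i] = 1%N ->
  exists2 m, m \in I & (i <= m)%N.
Proof.
move=> ri; have [/set0Pn[m]|] := boolP (I :&: upper n i != set0).
  by rewrite inE in_upper => /andP[mI leim]; exists m.
rewrite negbK => /eqP Ii; have := schubert_rank_le_cut I i [set i].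
rewrite ri /cut_value Ii cards0 addn0.
suff -> : [set i] :\: upper n i = set0 by rewrite cards0.
by apply/setP => z; rewrite !inE; case: eqP => [->|_]; rewrite ?leqnn ?andbF.
Qed.

Lemma schubert_rank_noncoloop I i :
  schubert_rank I (~: [set i]) = schubert_rank I setT ->
  exists2 a, a \notin I & (a <= i)%N.
Proof.
move=> rCi; have [|/subsetPn[a]] := boolP (~: upper n i.+1 \subset I); last first.
  by rewrite !inE -ltnNge ltnS => leai aI; exists a.
(* If [I] contains everything up to [i], the cut just after [i] bounds the rank of the complement of
   [i] by [#|I| - 1]. *)
move=> sI; have := schubert_rank_le_cut I i.+1 (~: [set i]).
have iI : i \in I by rewrite (subsetP sI) // !inE ltnn.
rewrite rCi schubert_rankT /cut_value -(cardsID (upper n i.+1) I) addnC leq_add2r.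
rewrite (cardsD1 i (I :\: _)) !inE ltnn iI add1n ltnNge subset_leq_card //.
by apply/subsetP => z; rewrite !inE => /andP[zi ->]; rewrite zi (subsetP sI) ?inE.
Qed.

Lemma schubert_rank_parallel I a m i :
    a \notin I -> m \in I -> (a < i)%N -> (i <= m)%N ->
  exists X, [/\ i \notin X, a \notin X,
    schubert_rank I (i |: X) = (schubert_rank I X).+1,
    schubert_rank I (a |: X) = (schubert_rank I X).+1 &
    schubert_rank I (i |: (a |: X)) = (schubert_rank I X).+1].
Proof.
move=> aI mI ltai leim.
(* The set will be [I :\ y], with [y = i] if [i] lies in [I] and [y = m] otherwise; both [i] and [a]
   complete it to a basis. *)
have [y [yI leiy iy]] : exists y, [/\ y \in I, (i <= y)%N & (i \notin I) || (i == y)].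
  by have [iI|iI] := boolP (i \in I); [exists i | exists m]; rewrite ?eqxx ?leim.
have ri : schubert_rank I (i |: (I :\ y)) = #|I|.
  case/orP: iy => [iI|/eqP ->]; last first.
    by rewrite setD1K // schubert_rank_base // schubert_base_self.
  rewrite schubert_rank_base // schubert_base_exchange //.
  by rewrite ltn_neqAle leiy andbT; apply: contraNneq iI => /val_inj ->.
have ra : schubert_rank I (a |: (I :\ y)) = #|I|.
  by rewrite schubert_rank_base // schubert_base_exchange // (leq_trans ltai).
have rX : (schubert_rank I (I :\ y)).+1 = #|I|.
  have /andP[_] := schubert_rank_setU1 I i (I :\ y); rewrite ri => leI.
  apply/eqP; rewrite eqn_leq leI andbT (cardsD1 y) yI add1n ltnS.
  exact: schubert_rank_le_card.
exists (I :\ y); rewrite rX ri ra; split=> //.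
- by rewrite !inE; case/orP: iy => [/negPf ->|->]; rewrite ?andbF.
- by rewrite !inE (negPf aI) andbF.
apply/eqP; rewrite eqn_leq schubert_rank_le_base -{1}ra.
by rewrite schubert_rank_mono ?subsetUr.
Qed.

End SchubertIndex.

(** * The ray of the fan spanned by the rank function *)

Section Prime.
Import boot.fintype boot.finset.
Local Open Scope ring_scope.
Variables (R : realType) (n : nat).
Implicit Types (I J L S X Y : {set 'I_n}) (f : setfun R n).

Definition schubert_fun I : setfun R n := [ffun S => (schubert_rank I S)%:R].

Lemma schubert_fun_submodular I : submodular (schubert_fun I).
Proof.
move=> X Y; rewrite !ffunE -!natrD ler_nat; exact: schubert_rank_submodular.
Qed.

Lemma schubert_fun_dctp I : dctp (schubert_fun I).
Proof.
split=> [|i j k X ijkX]; first exact: schubert_fun_submodular.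
rewrite /plucker_mid /plucker_term !ffunE -!natrD (schubert_rank_plucker I ijkX).
by rewrite natr_max.
Qed.

Lemma schubert_fun_integral I : integral_dctp (schubert_fun I).
Proof.
split=> [||S]; first exact: schubert_fun_dctp.
  by rewrite ffunE schubert_rank0.
by rewrite ffunE; apply: natr_int.
Qed.

(* Sum of the submodular defects at the pairs where [r] has none: the linear form
   that cuts out the face. *)
Definition submodular_defect (r : {set 'I_n} -> nat) f : R :=
  \sum_(XY : {set 'I_n} * {set 'I_n} |
        (r (XY.1 :&: XY.2) + r (XY.1 :|: XY.2) == r XY.1 + r XY.2)%N)
    (f XY.1 + f XY.2 - (f (XY.1 :&: XY.2) + f (XY.1 :|: XY.2))).

Lemma submodular_defect_linear r : scalar (submodular_defect r).
Proof.
move=> c f g; rewrite /submodular_defect mulr_sumr -big_split /=.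
by apply: eq_bigr => XY _; rewrite !ffunE /GRing.scale /=; lra.
Qed.

HB.instance Definition _ r := GRing.isLinear.Build R (setfun R n) R *%R
  (submodular_defect r) (submodular_defect_linear r).

Lemma submodular_defect_ge0 r f : submodular f -> 0 <= submodular_defect r f.
Proof. by move=> submod_f; apply: sumr_ge0 => XY _; rewrite subr_ge0. Qed.

Lemma submodular_defect_eq0 r f X Y : submodular f -> submodular_defect r f = 0 ->
    (r (X :&: Y) + r (X :|: Y) = r X + r Y)%N ->
  f (X :&: Y) + f (X :|: Y) = f X + f Y.
Proof.
move=> submod_f /eqP; rewrite psumr_eq0 => [|XY _]; last by rewrite subr_ge0.
move/allP/(_ (X, Y)); rewrite mem_index_enum => /(_ isT) /= /implyP tightXY.
by move/eqP/tightXY; rewrite subr_eq0 => /eqP ->.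
Qed.

Lemma schubert_fun_extreme I f : schubert_index I -> submodular f ->
    submodular_defect (schubert_rank I) f = 0 ->
  exists2 t : R, 0 <= t & lineality (f - t *: schubert_fun I).
Proof.
move=> hI submod_f defect0; have [a [m [aI amin mI mmax ltam]]] := schubert_indexP hI.
have parallel i : schubert_rank I [set i] = 1%N ->
    schubert_rank I (~: [set i]) = schubert_rank I setT -> i != a ->
    exists X, [/\ i \notin X, a \notin X,
      schubert_rank I (i |: X) = (schubert_rank I X).+1,
      schubert_rank I (a |: X) = (schubert_rank I X).+1 &
      schubert_rank I (i |: (a |: X)) = (schubert_rank I X).+1].
  move=> /schubert_rank_nonloop[y yI leiy] /schubert_rank_noncoloop[b bI lebi] neia.
  apply: (schubert_rank_parallel aI mI); last exact: leq_trans leiy (mmax y yI).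
  rewrite ltn_neqAle eq_sym neia /= (leq_trans _ lebi) // leqNgt.
  by apply: contraNN bI => /amin.
have fE := connected_rank_rigid (schubert_rank0 I)
  (schubert_rank_setU1 I) (schubert_rank_submodular I)
  (fun X Y => @submodular_defect_eq0 (schubert_rank I) f X Y submod_f defect0) parallel.
(* [gap f a] is the submodular defect of [f] at [[set a]] and its complement, hence nonnegative. *)
exists (gap f a).
  have := submod_f [set a] (~: [set a]); rewrite setICr setUCr /gap; lra.
exists (f set0), (fun i => f [set i] - f set0 - gap f a * (schubert_rank I [set i])%:R).
move=> S; rewrite !ffunE; apply: (canLR (addrK _)); exact: fE.
Qed.

(** An affine function gives [m] the same increment at [X] and at [a |: X], whereas parallel
    elements have rank increments 1 and 0. *)
Lemma schubert_fun_nonlineal I : schubert_index I -> ~ lineality (schubert_fun I).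
Proof.
case/schubert_indexP=> a [m [aI _ mI _ ltam]] [c [z rE]].
have [X [mX aX rm ra rma]] := schubert_rank_parallel aI mI ltam (leqnn m).
have maX : m \notin a |: X.
  by rewrite !inE negb_or mX andbT; apply: contraNneq aI => <-.
have := rE (m |: (a |: X)); have := rE (a |: X); have := rE (m |: X); have := rE X.
rewrite !ffunE !big_setU1 //= rm ra rma -addn1 natrD; lra.
Qed.

Lemma lineality0 : lineality (0 : setfun R n).
Proof. by exists 0, (fun=> 0) => S; rewrite ffunE big1 ?addr0. Qed.

Lemma linealityD f g : lineality f -> lineality g -> lineality (f + g).
Proof.
move=> [c [z fE]] [d [w gE]]; exists (c + d), (fun i => z i + w i) => S.
by rewrite ffunE fE gE big_split /=; lra.
Qed.

Lemma linealityN f : lineality f -> lineality (- f).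
Proof.
move=> [c [z fE]]; exists (- c), (fun i => - z i) => S.
by rewrite ffunE fE sumrN opprD.
Qed.

Lemma lin_class_eq f g : lineality (f - g) -> lin_class f = lin_class g.
Proof.
move=> fg; apply/seteqP; split=> h /= hf.
  by rewrite /lin_class /= -(subrKA f); apply: linealityD.
rewrite /lin_class /= -(subrKA g); apply: linealityD => //.
by rewrite -opprB; apply: linealityN.
Qed.

Lemma dctp_coneZ eps (t : R) f : 0 <= t ->
  dctp_cone eps f -> dctp_cone eps (t *: f).
Proof.
move=> t0 [submod_f pluck_f]; split=> [X Y|i j k X /pluck_f[]].
  by rewrite !ffunE /GRing.scale /= -!mulrDr ler_wpM2l.
rewrite /plucker_mid /plucker_term !ffunE /GRing.scale /=.
by case: (eps i j k X) => /= eqf lef; rewrite -!mulrDr eqf ler_wpM2l -?eqf.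
Qed.

Lemma dctp_in_cone f : dctp f -> exists eps, dctp_cone eps f.
Proof.
case=> submod_f pluck_f.
exists (fun i j k X => plucker_term false f i j k X <= plucker_term true f i j k X).
split=> // i j k X /pluck_f ->.
by case: leP => /= [le10|/ltW le01]; split=> //; apply/max_idPl.
Qed.

(** In a cone containing the rank function, the zero set of [submodular_defect] is a face; modulo
    lineality it consists of the nonnegative multiples of the rank function. *)
Lemma schubert_fun_ray I : schubert_index I -> spans_ray (schubert_fun I).
Proof.
move=> hI; split=> [class0|].
  apply: (schubert_fun_nonlineal hI); rewrite -[schubert_fun I]subr0.
  suff : lin_class 0 (schubert_fun I) by [].
  by rewrite -class0 /lin_class /= subrr; apply: lineality0.
have [eps coneI] := dctp_in_cone (schubert_fun_dctp I).
pose l : {scalar setfun R n} := submodular_defect (schubert_rank I).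
have l_ge0 f : dctp_cone eps f -> 0 <= l f.
  by case=> submod_f _; apply: submodular_defect_ge0.
exists [set f | dctp_cone eps f /\ l f = 0]%classic; first by exists eps, l.
apply/seteqP; split=> [_ [f [[submod_f _] lf0] <-]|_ [t /= t0 <-]].
  have [t t0 ft] := schubert_fun_extreme hI submod_f lf0.
  by exists t => //=; apply/esym/lin_class_eq.
exists (t *: schubert_fun I) => //=; split; first exact: dctp_coneZ.
rewrite linearZ /=; suff -> : submodular_defect (schubert_rank I) (schubert_fun I) = 0.
  by rewrite mulr0.
rewrite /submodular_defect big1 // => XY /eqP eqr.
by rewrite !ffunE -!natrD eqr subrr.
Qed.

Lemma schubert_polytopeE I : schubert_polytope R I = base_polytope (schubert_fun I).
Proof. by congr base_polytope; apply/funext => S; rewrite ffunE. Qed.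

Lemma schubert_polytope_prime I :
  schubert_index I -> prime_MV_polytope (schubert_polytope R I).
Proof.
move=> hI; exists (schubert_fun I); split; last exact: schubert_fun_ray.
  exact: schubert_fun_integral.
exact: schubert_polytopeE.
Qed.

(** * Indicators of bases and the support function of the polytope *)

Definition indicator L : 'rV[R]_n := \row_i (i \in L)%:R.

Lemma sum_indicator L S : \sum_(i in S) indicator L 0 i = #|S :&: L|%:R.
Proof.
under eq_bigr do rewrite mxE.
rewrite -natr_sum -sum1_card; congr _%:R.
rewrite big_mkcond [RHS]big_mkcond; apply: eq_bigr => i _.
by rewrite inE; case: (i \in S); case: (i \in L).
Qed.

Lemma indicator_schubert_polytope I L : L \in schubert_bases I ->
  schubert_polytope R I (indicator L).
Proof.
move=> LI; split=> [S _|]; first by rewrite sum_indicator ler_nat schubert_rank_ge.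
under eq_bigl => i do rewrite -[true](in_setT i).
by rewrite sum_indicator setTI schubert_rankT (schubert_base_card LI).
Qed.

Lemma schubert_polytope_le I x S : schubert_polytope R I x ->
  \sum_(i in S) x 0 i <= (schubert_rank I S)%:R.
Proof.
case=> xS xT; have [->|/eqP neT] := eqVneq S setT.
  by rewrite -xT; under eq_bigl do rewrite inE.
by apply: xS; rewrite properEneq subsetT andbT; apply/eqP.
Qed.

(* [schubert_rank I] is the support function of the polytope. *)
Lemma schubert_rank_translate I J (z : 'rV[R]_n) :
    schubert_polytope R I = translate z (schubert_polytope R J) ->
  forall S, (schubert_rank I S)%:R = \sum_(i in S) z 0 i + (schubert_rank J S)%:R.
Proof.
move=> QIJ S; apply/eqP; rewrite eq_le; apply/andP; split.
  (* The indicator of a basis of [I] optimal on [S] is [z] plus a point of the polytope of [J],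
     whose sum over [S] is bounded by the rank for [J]. *)
  have [L LI ->] := schubert_rankP I S; rewrite -sum_indicator.
  have := indicator_schubert_polytope LI; rewrite QIJ => -[y Jy <-].
  under eq_bigr do rewrite mxE.
  by rewrite big_split lerD2l schubert_polytope_le.
have [L LJ ->] := schubert_rankP J S; rewrite -sum_indicator -big_split /=.
have : schubert_polytope R I (z + indicator L).
  by rewrite QIJ; exists (indicator L) => //; apply: indicator_schubert_polytope.
move/(schubert_polytope_le S); rewrite (eq_bigr (fun i => z 0 i + indicator L 0 i)) //.
by move=> i _; rewrite mxE.
Qed.

End Prime.

(** * Recovering the index set from the rank function up to translation *)

Section Distinct.
Import boot.fintype boot.finset.
Variable n : nat.
Implicit Types (I J S : {set 'I_n}).

(** [I] has full rank for [J] too, so the cut of [I] at [p] in the matroid of [J] is at least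
    [#|I|]. *)
Lemma schubert_rank_subset_base I J :
    schubert_rank I =1 schubert_rank J ->
  forall p, (#|I :&: upper n p| <= #|J :&: upper n p|)%N.
Proof.
move=> rIJ p; have := schubert_rank_le_cut J p I.
rewrite -rIJ schubert_rank_base ?schubert_base_self // /cut_value.
by rewrite -(cardsID (upper n p) I) addnC leq_add2l.
Qed.

Lemma schubert_rank_inj I J : schubert_rank I =1 schubert_rank J -> I = J.
Proof.
move=> rIJ; have upE p : #|I :&: upper n p| = #|J :&: upper n p|.
  by apply/eqP; rewrite eqn_leq !schubert_rank_subset_base // => S; rewrite rIJ.
have stepE K (i : 'I_n) : #|K :&: upper n i| = ((i \in K) + #|K :&: upper n i.+1|)%N.
  rewrite (cardsD1 i) !inE leqnn andbT; congr (_ + _)%N; apply: eq_card => z.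
  by rewrite !inE ltn_neqAle val_eqE eq_sym andbCA.
apply/setP => i; have := upE i; rewrite !stepE upE => /addIn.
by case: (i \in I); case: (i \in J).
Qed.

(* The condition on [k], "neither loop nor coloop", is unchanged when a modular
   function is added to the rank function. *)
Lemma schubert_rank_set1 I i : schubert_index I ->
  schubert_rank I [set i] = [exists k : 'I_n, [&& (i <= k)%N,
    schubert_rank I [set k] == 1%N &
    schubert_rank I (~: [set k]) == schubert_rank I setT]].
Proof.
move=> hI; have [a [m [aI _ mI mmax ltam]]] := schubert_indexP hI.
have le1 : (schubert_rank I [set i] <= 1)%N.
  by rewrite (leq_trans (schubert_rank_le_card _ _)) ?cards1.
have rle (k : 'I_n) : (k <= m)%N -> schubert_rank I [set k] = 1%N.
  move=> lekm; apply/eqP; rewrite eqn_leq.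
  rewrite (leq_trans (schubert_rank_le_card _ _)) ?cards1 //=.
  have [kI|kI] := boolP (k \in I).
    by have := schubert_rank_ge [set k] (schubert_base_self I); rewrite (setIidPl _) ?sub1set ?cards1.
  have ltkm : (k < m)%N by rewrite ltn_neqAle lekm andbT; apply: contraNneq kI => /val_inj ->.
  have := schubert_rank_ge [set k] (schubert_base_exchange mI kI ltkm).
  by rewrite (setIidPl _) ?cards1 // sub1set setU11.
case: existsP => [[k /and3P[leik /eqP rk _]]|nok].
  have [y yI leky] := schubert_rank_nonloop rk.
  by rewrite rle // (leq_trans leik) // (leq_trans leky) ?mmax.
(* The maximum [m] of [I] is not a coloop: exchanging it for [a] gives a basis avoiding [m]. *)
apply/eqP; rewrite -leqn0 leqNgt; apply/negP => r_gt0; apply: nok; exists m.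
have ri : schubert_rank I [set i] = 1%N by apply/eqP; rewrite eqn_leq le1.
have [y yI leiy] := schubert_rank_nonloop ri.
rewrite (leq_trans leiy (mmax _ yI)) rle //= eqn_leq schubert_rank_mono ?subsetT //=.
rewrite schubert_rankT -(schubert_rank_base (schubert_base_exchange mI aI ltam)).
rewrite schubert_rank_mono //; apply/subsetP => z; rewrite !inE.
by case/orP=> [/eqP ->|/andP[]//]; apply: contraTneq ltam => ->; rewrite ltnn.
Qed.

Lemma schubert_rank_translate_eq (R : realDomainType) I J (z : 'I_n -> R) :
    schubert_index I -> schubert_index J ->
    (forall S, (schubert_rank I S)%:R = \sum_(i in S) z i + (schubert_rank J S)%:R)%R ->
  I = J.
Proof.
move=> hI hJ rIJ; apply: schubert_rank_inj.
have z1 i : ((schubert_rank I [set i])%:R = z i + (schubert_rank J [set i])%:R)%R.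
  by rewrite rIJ big_set1.
have zC i : ((schubert_rank I setT)%:R - (schubert_rank I (~: [set i]))%:R =
   z i + ((schubert_rank J setT)%:R - (schubert_rank J (~: [set i]))%:R))%R.
  by rewrite !rIJ -(setUCr [set i]) big_setU1 ?inE ?negbK ?eqxx //=; lra.
have mid_bound (K : {set 'I_n}) i : (schubert_rank K [set i] <= 1)%N &&
    (schubert_rank K (~: [set i]) <= schubert_rank K setT)%N.
  rewrite schubert_rank_mono ?subsetT // andbT.
  by rewrite (leq_trans (schubert_rank_le_card _ _)) ?cards1.
have midE i : (schubert_rank I [set i] == 1%N) &&
    (schubert_rank I (~: [set i]) == schubert_rank I setT) =
    (schubert_rank J [set i] == 1%N) &&
    (schubert_rank J (~: [set i]) == schubert_rank J setT).
  (* Eliminating [z i] shows that the rank of [i] plus that of its complement minus the total rank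
     is the same for [I] and [J]; by [mid_bound] it is 1 exactly for elements that are neither loops
     nor coloops. *)
  have : (schubert_rank I [set i] + schubert_rank I (~: [set i]) + schubert_rank J setT)%N =
         (schubert_rank J [set i] + schubert_rank J (~: [set i]) + schubert_rank I setT)%N.
    apply/eqP; rewrite -(eqr_nat R) !natrD; apply/eqP.
    by have := z1 i; have := zC i; lra.
  by move: (mid_bound I i) (mid_bound J i); lia.
have r1 i : schubert_rank I [set i] = schubert_rank J [set i].
  rewrite !schubert_rank_set1 //; congr nat_of_bool.
  by apply: eq_existsb => k; rewrite midE.
have z0 i : z i = 0%R by have := z1 i; rewrite r1; lra.
move=> S; have /eqP := rIJ S; rewrite big1 => [|i _]; last exact: z0.
by rewrite add0r eqr_nat => /eqP.
Qed.
End Distinct.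

Theorem proposition1p1 (R : realType) (n : nat) :
  (forall I : {set 'I_n}, schubert_index I ->
     prime_MV_polytope (schubert_polytope R I)) /\
  (forall I J : {set 'I_n}, schubert_index I -> schubert_index J -> I <> J ->
     stable_MV (schubert_polytope R I) <> stable_MV (schubert_polytope R J)).
Proof.
split=> [I|I J hI hJ neIJ stIJ]; first exact: schubert_polytope_prime.
have : stable_MV (schubert_polytope R I) (schubert_polytope R I).
  split; last first.
    exists 0%R; apply/seteqP; split=> [x Qx|_ [x Qx <-]]; last by rewrite add0r.
    by exists x => //; rewrite add0r.
  exists (schubert_fun R I); last exact: schubert_polytopeE.
  exact: schubert_fun_integral.
rewrite stIJ => -[_ [z QIJ]]; apply: neIJ.
exact: (schubert_rank_translate_eq hI hJ (schubert_rank_translate QIJ)).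
Qed.
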